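(* Let $I$ be a monomial ideal in the polynomial ring $S=\kappa[x_1,\ldots,x_n]$ over a field $\kappa$ with $\gcd(I)\ne1$. Let $\mathbf{n}\in\mathrm{MinGens}(I)$, $\mathbf{m}\in C_I(\mathbf{n})$, and $j>0$. Then for all $1\neq\mathbf{u}\in\mathbb{L}_{I+(\mathbf{m})}$, $$\beta_{j,\mathbf{u}}(S/(I+(\mathbf{m})))=\begin{cases}1 & j=1,\ \mathbf{u}=\mathbf{m}\\ 0 & j=1,\ \mathbf{u}=\mathbf{n},\ \mathbf{m}\mid\mathbf{n}\\ \beta_{j,\mathbf{u}}(S/I)+1 & j=2,\ \mathbf{u}=\mathrm{lcm}(\mathbf{m},\mathbf{n}),\ \mathbf{m}\nmid\mathbf{n}\\ \beta_{j,\mathbf{u}}(S/I) & \text{otherwise;}\end{cases}$$ for all $p\ge0$, $$\beta_{j,p}(S/(I+(\mathbf{m})))=\begin{cases}\beta_{j,p}(S/I)+1 & j=1,\ p=\deg(\mathbf{m}),\ \deg(\mathbf{n})\neq p\\ \beta_{j,p}(S/I)+1 & j=1,\ p=\deg(\mathbf{m}),\ \mathbf{m}\nmid\mathbf{n}\\ \beta_{j,p}(S/I)-1 & j=1,\ p=\deg(\mathbf{n}),\ \mathbf{m}\mid\mathbf{n}\\ \beta_{j,p}(S/I)+1 & j=2,\ p=\deg(\mathrm{lcm}(\mathbf{m},\mathbf{n})),\ \mathbf{m}\nmid\mathbf{n}\\ \beta_{j,p}(S/I) & \text{otherwise;}\end{cases}$$ and $$\beta_{j}(S/(I+(\mathbf{m})))=\begin{cases}\beta_j(S/I)+1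 & j\in\{1,2\},\ \mathbf{m}\nmid\mathbf{n}\\ \beta_j(S/I) & \text{otherwise.}\end{cases}$$
   Context: $\mathrm{MinGens}(I)$ is the unique minimal monomial generating set of $I$; $\gcd(I)$ is the gcd of its elements. $\mathbb{L}_I$ is the lcm lattice of $I$: the set of lcms of subsets of $\mathrm{MinGens}(I)$ (with $\mathrm{lcm}(\emptyset)=1$). For monomials $\mathbf{u}=x_1^{g_1}\cdots x_n^{g_n}$ and $\mathbf{n}=x_1^{c_1}\cdots x_n^{c_n}$ with $\mathbf{u}\mid\mathbf{n}$, $C_{\mathbf{u}}(\mathbf{n})$ is the set of monomials $x_1^{d_1}\cdots x_n^{d_n}\ne1$ such that $d_i\ge c_i$ for every $i$ with $c_i\neq g_i$, and $d_i<c_i$ for at least one $i$ with $c_i=g_i$. For a monomial $\mathbf{n}\in I$, $C_I(\mathbf{n})=C_{\gcd(I)}(\mathbf{n})$. $\beta_j$, $\beta_{j,p}$, $\beta_{j,\mathbf{u}}$ denote total, graded and $\mathbb{N}^n$-multigraded Betti numbers (a multidegree is identified with the corresponding monomial); $\deg$ is total degree of a monomial. *)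

(* Defs.v *)
From HB Require Import structures.
From mathcomp Require Import all_boot all_order all_algebra.
From mathcomp Require Export mpoly.

Set Implicit Arguments.
Unset Strict Implicit.
Unset Printing Implicit Defensive.

Import GRing.Theory.
Local Open Scope ring_scope.

(* An ideal of {mpoly K[n]} is given by its membership predicate; a monomial
   x^c is given by its exponent vector c : 'X_{1..n}, so that the monomial 1 is
   0%MM, divisibility of monomials is (_ <= _)%MM and the total degree is
   mdeg. *)

Definition ideal_gen (K : fieldType) (n : nat) (G : 'X_{1..n} -> Prop)
    (f : {mpoly K[n]}) : Prop :=
  exists (r : nat) (g : 'I_r -> 'X_{1..n}) (q : 'I_r -> {mpoly K[n]}),
    (forall i, G (g i)) /\ f = \sum_(i < r) q i * 'X_[g i].

Definition generates (K : fieldType) (n : nat) (G : 'X_{1..n} -> Prop)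
    (I : {mpoly K[n]} -> Prop) : Prop :=
  forall f, I f <-> ideal_gen G f.

Definition monomial_ideal (K : fieldType) (n : nat)
    (I : {mpoly K[n]} -> Prop) : Prop :=
  exists G : 'X_{1..n} -> Prop, generates G I.

Definition minimal_generating_set (K : fieldType) (n : nat)
    (I : {mpoly K[n]} -> Prop) (G : 'X_{1..n} -> Prop) : Prop :=
  generates G I /\
  forall H : 'X_{1..n} -> Prop,
    (forall c, H c -> G c) -> generates H I -> forall c, G c -> H c.

(* A monomial ideal has exactly one minimal monomial generating set, so the
   existential quantifier only names it. *)
Definition MinGens (K : fieldType) (n : nat) (I : {mpoly K[n]} -> Prop)
    (c : 'X_{1..n}) : Prop :=
  exists G : 'X_{1..n} -> Prop, minimal_generating_set I G /\ G c.

Definition mpoly_dvd (K : fieldType) (n : nat) (f h : {mpoly K[n]}) : Prop :=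
  exists q : {mpoly K[n]}, h = q * f.

(* The monomial x^g is the gcd of the elements of I. *)
Definition is_gcd (K : fieldType) (n : nat) (I : {mpoly K[n]} -> Prop)
    (g : 'X_{1..n}) : Prop :=
  (forall f, I f -> mpoly_dvd 'X_[g] f) /\
  (forall h, (forall f, I f -> mpoly_dvd h f) -> mpoly_dvd h 'X_[g]).

(* I + (x^m) *)
Definition ideal_add (K : fieldType) (n : nat) (I : {mpoly K[n]} -> Prop)
    (m : 'X_{1..n}) (f : {mpoly K[n]}) : Prop :=
  exists (h q : {mpoly K[n]}), I h /\ f = h + q * 'X_[m].

Definition lcm_lattice (K : fieldType) (n : nat) (I : {mpoly K[n]} -> Prop)
    (u : 'X_{1..n}) : Prop :=
  exists s : seq 'X_{1..n},
    (forall c, c \in s -> MinGens I c) /\ u = \big[@mlcm n/0%MM]_(c <- s) c.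

(* d belongs to C_g(c); meant for g dividing c. *)
Definition Cset (n : nat) (g c d : 'X_{1..n}) : Prop :=
  [/\ d <> 0%MM,
      forall i, c i <> g i -> (c i <= d i)%N
    & exists i, c i = g i /\ (d i < c i)%N].

(* Multigraded sequences ... -> F_2 -> F_1 -> F_0 -> S/I of finitely generated
   free S-modules, where S = {mpoly K[n]}.  F_j is the space of row vectors of
   length rk j, its i-th basis vector has multidegree shift i (that is,
   F_j is the direct sum of the S(- shift i)), and diff j : F_(j+1) -> F_j acts
   by multiplication on the right.  The entries of aug represent the images in
   S/I of the basis vectors of F_0. *)
Record free_seq (K : fieldType) (n : nat) := FreeSeq {
  rk : nat -> nat;
  shift : forall j, 'I_(rk j) -> 'X_{1..n};
  diff : forall j, 'M[{mpoly K[n]}]_(rk j.+1, rk j);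
  aug : 'cV[{mpoly K[n]}]_(rk 0)
}.

Definition multihomogeneous (K : fieldType) (n : nat) (F : free_seq K n) :
    Prop :=
  (forall i c, c \in msupp (aug F i ord0) -> c = shift i) /\
  (forall j (a : 'I_(rk F j.+1)) (b : 'I_(rk F j)) c,
     c \in msupp (diff F j a b) -> (c + shift b)%MM = shift a).

Definition resolves (K : fieldType) (n : nat) (I : {mpoly K[n]} -> Prop)
    (F : free_seq K n) : Prop :=
  [/\ forall f, exists v : 'rV_(rk F 0), I (f - (v *m aug F) ord0 ord0),
      forall v : 'rV_(rk F 0),
        I ((v *m aug F) ord0 ord0) <-> exists w, v = w *m diff F 0
    & forall j (v : 'rV_(rk F j.+1)),
        v *m diff F j = 0 <-> exists w, v = w *m diff F j.+1].

(* diff maps F_(j+1) into (x_1, ..., x_n) F_j. *)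
Definition minimal (K : fieldType) (n : nat) (F : free_seq K n) : Prop :=
  forall j a b, (diff F j a b)@_0%MM = 0.

Definition minimal_free_resolution (K : fieldType) (n : nat)
    (I : {mpoly K[n]} -> Prop) (F : free_seq K n) : Prop :=
  [/\ multihomogeneous F, resolves I F & minimal F].

(* The Betti numbers of S/I are those read off from a minimal free resolution
   F of S/I. *)
Definition mbetti (K : fieldType) (n : nat) (F : free_seq K n) (j : nat)
    (u : 'X_{1..n}) : nat :=
  #|[set i : 'I_(rk F j) | shift i == u]|.

Definition gbetti (K : fieldType) (n : nat) (F : free_seq K n) (j p : nat) :
    nat :=
  #|[set i : 'I_(rk F j) | mdeg (shift i) == p]|.

Definition betti (K : fieldType) (n : nat) (F : free_seq K n) (j : nat) : nat :=
  rk F j.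

(* Main.v *)
(* Write [g] for the gcd of [I].  Every element of [I] is divisible by x^g, and
   [nu] agrees with [g] wherever it exceeds [mu], so the colon ideal (I : x^mu)
   is principal, generated by lcm(mu, nu) / mu.  Hence S/(I + (x^mu)) is resolved
   by the mapping cone of a map from [0 -> S(- lcm(mu, nu)) -> S(- mu)] to a
   minimal resolution F of S/I.  The cone is minimal when mu does not divide nu:
   it has one more generator in degrees 1 and 2.  When mu divides nu, the new
   generator in degree 2 cancels against the basis vector of multidegree nu in
   F_1, so that F only has that basis vector replaced by one of multidegree mu.
   Betti numbers do not depend on the minimal resolution, because comparison maps
   between two of them become mutually inverse modulo (x_1, ..., x_n). *)

Require Import Defs.
From HB Require Import structures.
From mathcomp Require Import all_boot all_order all_algebra.
From mathcomp Require Import mpoly.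

Set Implicit Arguments.
Unset Strict Implicit.
Unset Printing Implicit Defensive.

Import GRing.Theory.
Local Open Scope ring_scope.

(** * Monomial ideals, tested monomial by monomial *)

Lemma ideal_genP (K : fieldType) (n : nat) (G : 'X_{1..n} -> Prop)
    (f : {mpoly K[n]}) :
  ideal_gen G f <->
  forall c, c \in msupp f -> exists g, G g /\ (g <= c)%MM.
Proof.
split=> [[r [g [q [Gg ->]]]] c cf | Gf].
  have [i ci] : exists i, c \in msupp (q i * 'X_[g i]).
    apply/existsP; apply: contraLR cf => /existsPn nc.
    rewrite mcoeff_msupp negbK raddf_sum /= big1 // => i _.
    exact: memN_msupp_eq0 (nc i).
  exists (g i); split; first exact: Gg.
  move: ci; rewrite (perm_mem (msuppMX _ _)) => /mapP[d _ ->].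
  exact: lem_addr.
(* Each term of [f] is by itself a multiple of one generator; a combination for [f] is then
   assembled by induction on the support. *)
have {Gf} : forall c, c \in msupp f -> exists g : 'X_{1..n},
    G g /\ exists q : {mpoly K[n]}, f@_c *: 'X_[c] = q * 'X_[g].
  move=> c /Gf[g [Gg gc]]; exists g; split=> //; exists (f@_c *: 'X_[c - g]).
  by rewrite -scalerAl -mpolyXD submK.
rewrite [f in ideal_gen G f]mpolyE.
elim: (msupp f) => [|c s IHs] hs.
  rewrite big_nil; exists 0, (fun=> 0%MM), (fun=> 0).
  by split=> [[]//|]; rewrite big_ord0.
have [|r [g [q [Gg eq_f]]]] := IHs.
  by move=> d ds; apply: hs; rewrite inE ds orbT.
have [|g1 [Gg1 [q1 eq1]]] := hs c; first by rewrite mem_head.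
exists r.+1, (oapp g g1 \o unlift ord0), (oapp q q1 \o unlift ord0).
split=> [i|]; first by rewrite /=; case: (unlift _ i) => //=.
rewrite big_cons eq_f eq1 big_ord_recl /= unlift_none /=; congr (_ + _).
by apply: eq_bigr => i _; rewrite liftK.
Qed.

Lemma monomial_idealP (K : fieldType) (n : nat) (I : {mpoly K[n]} -> Prop) :
  monomial_ideal I ->
  forall f, I f <-> forall c, c \in msupp f -> I 'X_[c].
Proof.
move=> [G hG] f; rewrite hG ideal_genP.
split=> h c cf; last first.
  by move/hG: (h c cf) => /ideal_genP; apply; rewrite msuppX inE.
have [g [Gg gc]] := h c cf.
apply/hG/ideal_genP => d; rewrite msuppX inE => /eqP->.
by exists g.
Qed.

Lemma monomial_ideal_add (K : fieldType) (n : nat) (I : {mpoly K[n]} -> Prop)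
  (m : 'X_{1..n}) : monomial_ideal I -> monomial_ideal (ideal_add I m).
Proof.
move=> [G hG]; exists (fun c => G c \/ c = m) => f; split.
  move=> [h [q [/hG/ideal_genP hh ->]]]; apply/ideal_genP => c /msuppD_le.
  rewrite mem_cat => /orP[/hh[g [Gg gc]]|]; first by exists g; split; [left|].
  rewrite (perm_mem (msuppMX _ _)) => /mapP[d _ ->].
  by exists m; split; [right | exact: lem_addr].
move=> [r [g [q [Gg ->]]]].
elim: r g q Gg => [|r IHr] g q Gg.
  rewrite big_ord0; exists 0, 0; rewrite mul0r addr0; split=> //.
  by apply/hG/ideal_genP => c; rewrite msupp0.
rewrite big_ord_recl.
have [//|h [q' [Ih ->]]] :=
  IHr (fun i => g (lift ord0 i)) (fun i => q (lift ord0 i)).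
have [G0|->] := Gg ord0; last first.
  by exists h, (q ord0 + q'); split=> //; rewrite mulrDl addrCA addrA.
exists (q ord0 * 'X_[g ord0] + h), q'; rewrite addrA; split=> //.
apply/hG/ideal_genP => c /msuppD_le; rewrite mem_cat => /orP[|].
  rewrite (perm_mem (msuppMX _ _)) => /mapP[d _ ->].
  by exists (g ord0); split=> //; exact: lem_addr.
by move/hG/ideal_genP: Ih; apply.
Qed.

Lemma monomial_ideal0 (K : fieldType) (n : nat) (I : {mpoly K[n]} -> Prop) :
  monomial_ideal I -> I 0.
Proof. by move=> hI; apply/(monomial_idealP hI) => c; rewrite msupp0. Qed.

Lemma monomial_idealD (K : fieldType) (n : nat) (I : {mpoly K[n]} -> Prop)
    (f h : {mpoly K[n]}) :
  monomial_ideal I -> I f -> I h -> I (f + h).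
Proof.
move=> hI /(monomial_idealP hI) If /(monomial_idealP hI) Ih.
apply/(monomial_idealP hI) => c /msuppD_le; rewrite mem_cat => /orP[].
  exact: If.
exact: Ih.
Qed.

Lemma monomial_idealM (K : fieldType) (n : nat) (I : {mpoly K[n]} -> Prop)
    (q f : {mpoly K[n]}) :
  monomial_ideal I -> I f -> I (q * f).
Proof.
move=> [G hG] /hG[r [g [p [Gg ->]]]]; apply/hG.
exists r, g, (fun i => q * p i); split=> //.
by rewrite mulr_sumr; apply: eq_bigr => i _; rewrite mulrA.
Qed.

Lemma monomial_idealN (K : fieldType) (n : nat) (I : {mpoly K[n]} -> Prop)
    (f : {mpoly K[n]}) :
  monomial_ideal I -> I f -> I (- f).
Proof. by move=> hI If; rewrite -mulN1r; apply: monomial_idealM. Qed.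

Lemma monomial_ideal_sum (K : fieldType) (n : nat) (I : {mpoly K[n]} -> Prop)
    (T : finType) (f : T -> {mpoly K[n]}) :
  monomial_ideal I -> (forall i, I (f i)) -> I (\sum_i f i).
Proof.
move=> hI If; apply: (big_ind I) => //; first exact: monomial_ideal0.
by move=> x y; apply: monomial_idealD.
Qed.

Lemma monomial_ideal_row (K : fieldType) (n : nat) (I : {mpoly K[n]} -> Prop)
    (p q : nat) (v : 'rV[{mpoly K[n]}]_p) (A : 'M[{mpoly K[n]}]_(p, q)) j :
  monomial_ideal I -> (forall i, I (A i j)) -> I ((v *m A) ord0 j).
Proof.
by move=> hI hA; rewrite mxE; apply: monomial_ideal_sum => // i;
   apply: monomial_idealM.
Qed.

(** * Homogeneous maps and projection onto homogeneous components *)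

(* A homogeneous map S(-s) -> S(-t). *)
Definition mhom (K : fieldType) (n : nat) (s t : 'X_{1..n})
  (p : {mpoly K[n]}) : Prop := forall c, c \in msupp p -> (c + t)%MM = s.

(** The exponent [k] is determined by [k + t = s], so the support has at most one element. *)
Lemma mhomP (K : fieldType) (n : nat) (s t : 'X_{1..n}) (p : {mpoly K[n]}) :
  mhom s t p ->
  p = 0 \/ exists k x, [/\ (k + t)%MM = s, x != 0 & p = x *: 'X_[k]].
Proof.
move=> hp; have [->|/eqP p0] := eqVneq p 0; [by left | right].
have [k kp] : exists k, k \in msupp p.
  case E : (msupp p) => [|k u]; first by case: p0; exact: msuppnil0.
  by exists k; rewrite mem_head.
exists k, p@_k; split; [exact: hp | by rewrite -mcoeff_msupp |].
apply/mpolyP => c; rewrite mcoeffZ mcoeffX.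
have [<-|/eqP nkc] := eqVneq k c; first by rewrite mulr1.
rewrite mulr0; apply: memN_msupp_eq0; apply/negP => /hp.
by rewrite -(hp k kp) => E; apply: nkc; rewrite -[k](addmK t) -E addmK.
Qed.

Lemma mhomZX (K : fieldType) (n : nat) (s t k : 'X_{1..n}) (x : K) :
  (k + t)%MM = s -> mhom s t (x *: 'X_[k]).
Proof. by move=> E c /msuppZ_le; rewrite msuppX inE => /eqP->. Qed.

Lemma mhom0 (K : fieldType) (n : nat) (s t : 'X_{1..n}) :
  mhom s t (0 : {mpoly K[n]}).
Proof. by move=> c; rewrite msupp0. Qed.

(** The component of [p] that is homogeneous as a map S(-s) -> S(-t). Multigraded pieces of S have
    dimension at most one, so it is a single term, or 0 when x^t does not divide x^s. *)
Definition hpart (K : fieldType) (n : nat) (s t : 'X_{1..n})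
    (p : {mpoly K[n]}) : {mpoly K[n]} :=
  if (t <= s)%MM then p@_(s - t) *: 'X_[s - t] else 0.

Lemma hpart_hom (K : fieldType) (n : nat) (s t : 'X_{1..n})
  (p : {mpoly K[n]}) : mhom s t (hpart s t p).
Proof.
rewrite /hpart; case: ifP => ts; last exact: mhom0.
by apply: mhomZX; rewrite submK.
Qed.

Lemma hpart_id (K : fieldType) (n : nat) (s t : 'X_{1..n}) (p : {mpoly K[n]}) :
  mhom s t p -> hpart s t p = p.
Proof.
rewrite /hpart => /mhomP[->|[k [x [<- _ ->]]]].
  by rewrite mcoeff0 scale0r if_same.
by rewrite lem_addl addmK mcoeffZ mcoeffX eqxx mulr1.
Qed.

Lemma hpart_sum (K : fieldType) (n : nat) (s t : 'X_{1..n}) (T : finType)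
    (f : T -> {mpoly K[n]}) :
  hpart s t (\sum_i f i) = \sum_i hpart s t (f i).
Proof.
rewrite /hpart; case: ifP => _; last by rewrite big1.
by rewrite raddf_sum scaler_suml.
Qed.

Lemma hpartB (K : fieldType) (n : nat) (s t : 'X_{1..n}) (p q : {mpoly K[n]}) :
  hpart s t (p - q) = hpart s t p - hpart s t q.
Proof.
by rewrite /hpart; case: ifP => _; rewrite ?subr0 // raddfB scalerBl.
Qed.

(** Projection commutes with composition by a homogeneous map. When x^t does not divide x^s, the
    right side is 0, and so is the left: every monomial of [p * q] is a multiple of the monomial of
    [q], which then does not divide x^(s - r). *)
Lemma hpartM (K : fieldType) (n : nat) (s t r : 'X_{1..n})
    (p q : {mpoly K[n]}) :
  mhom t r q -> hpart s r (p * q) = hpart s t p * q.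
Proof.
move=> /mhomP[->|[k [x [<- _ ->]]]].
  by rewrite !mulr0 hpart_id //; exact: mhom0.
rewrite /hpart; case: (boolP (k + r <= s)%MM) => [krs|].
  have rs : (r <= s)%MM by apply: lepm_trans krs; exact: lem_addl.
  have E : (s - r = k + (s - (k + r)))%MM.
    by rewrite -{1}(submK krs) addmA addmK addmC.
  rewrite rs E; set e := (s - (k + r))%MM.
  rewrite -!scalerAr mcoeffZ mcoeffMX -scalerAl -mpolyXD scalerA.
  by rewrite (addmC e).
rewrite mul0r => nkrs; case: ifP => // rs.
rewrite -scalerAr mcoeffZ (memN_msupp_eq0 (p := p * _)) ?mulr0 ?scale0r //.
apply: contra nkrs; rewrite (perm_mem (msuppMX _ _)) => /mapP[d _ E].
rewrite -(submK rs) E; apply/mnm_lepP => i; rewrite !mnmDE leq_add2r.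
exact: leq_addr.
Qed.

Lemma hpart_ideal (K : fieldType) (n : nat) (I : {mpoly K[n]} -> Prop)
    (s t : 'X_{1..n}) (p : {mpoly K[n]}) :
  monomial_ideal I -> I p -> I (hpart s t p).
Proof.
move=> hI /(monomial_idealP hI) Ip; rewrite /hpart.
case: ifP => _; last exact: monomial_ideal0.
have [->|p0] := eqVneq p@_(s - t) 0; first by rewrite scale0r;
  exact: monomial_ideal0.
rewrite -mul_mpolyC; apply: monomial_idealM => //; apply: Ip.
by rewrite mcoeff_msupp.
Qed.

Definition mhom_mx (K : fieldType) (n p q : nat) (s : 'I_p -> 'X_{1..n})
    (t : 'I_q -> 'X_{1..n}) (A : 'M[{mpoly K[n]}]_(p, q)) : Prop :=
  forall a b, mhom (s a) (t b) (A a b).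

Definition hpartmx (K : fieldType) (n p q : nat) (s : 'I_p -> 'X_{1..n})
    (t : 'I_q -> 'X_{1..n}) (A : 'M[{mpoly K[n]}]_(p, q)) :
    'M[{mpoly K[n]}]_(p, q) :=
  \matrix_(a, b) hpart (s a) (t b) (A a b).

Lemma hpartmx_hom (K : fieldType) (n p q : nat) (s : 'I_p -> 'X_{1..n})
    (t : 'I_q -> 'X_{1..n}) (A : 'M[{mpoly K[n]}]_(p, q)) :
  mhom_mx s t (hpartmx s t A).
Proof. by move=> a b; rewrite mxE; exact: hpart_hom. Qed.

Lemma hpartmx_id (K : fieldType) (n p q : nat) (s : 'I_p -> 'X_{1..n})
    (t : 'I_q -> 'X_{1..n}) (A : 'M[{mpoly K[n]}]_(p, q)) :
  mhom_mx s t A -> hpartmx s t A = A.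
Proof. by move=> hA; apply/matrixP => a b; rewrite mxE hpart_id. Qed.

(** Lets any lift through a homogeneous matrix be replaced by a homogeneous lift. *)
Lemma hpartmxM (K : fieldType) (n p q r : nat) (s : 'I_p -> 'X_{1..n})
    (t : 'I_q -> 'X_{1..n}) (u : 'I_r -> 'X_{1..n})
    (A : 'M[{mpoly K[n]}]_(p, q)) (B : 'M[{mpoly K[n]}]_(q, r)) :
  mhom_mx t u B -> hpartmx s u (A *m B) = hpartmx s t A *m B.
Proof.
move=> hB; apply/matrixP => a c; rewrite !mxE hpart_sum.
by apply: eq_bigr => b _; rewrite (hpartM _ _ (hB b c)) mxE.
Qed.

Lemma mhom_mxM (K : fieldType) (n p q r : nat) (s : 'I_p -> 'X_{1..n})
    (t : 'I_q -> 'X_{1..n}) (u : 'I_r -> 'X_{1..n})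
    (A : 'M[{mpoly K[n]}]_(p, q)) (B : 'M[{mpoly K[n]}]_(q, r)) :
  mhom_mx s t A -> mhom_mx t u B -> mhom_mx s u (A *m B).
Proof.
move=> hA hB; rewrite -(hpartmx_id hA) -(hpartmxM _ _ hB); exact: hpartmx_hom.
Qed.

(** * Matrices built row by row, and a rank bound for graded matrices *)

Lemma exists_rows (U : nmodType) (p q : nat) (P : 'I_p -> 'rV[U]_q -> Prop) :
  (forall i, exists v, P i v) ->
  exists A : 'M[U]_(p, q), forall i, P i (row i A).
Proof.
(* Induction on the number of rows makes the finitely many choices. *)
elim: p P => [|p IHp] P hP.
  by exists 0; case.
have [A hA] := IHp (fun i => P (lift ord0 i)) (fun i => hP (lift ord0 i)).
have [v hv] := hP ord0.
exists (\matrix_(i, j) if unlift ord0 i is Some k then A k j else v ord0 j).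
move=> i; case: (unliftP ord0 i) => [k|] ->.
  suff -> : row (lift ord0 k) (\matrix_(i, j)
    if unlift ord0 i is Some k then A k j else v ord0 j) = row k A by exact: hA.
  by apply/rowP => j; rewrite !mxE liftK.
suff -> : row ord0 (\matrix_(i, j)
    if unlift ord0 i is Some k then A k j else v ord0 j) = v by [].
by apply/rowP => j; rewrite !mxE unlift_none.
Qed.

Lemma mx_lift (R : pzRingType) (p q r m : nat) (d : 'M[R]_(q, r))
    (e : 'M[R]_(m, q)) (A : 'M[R]_(p, q)) :
  (forall v : 'rV_q, v *m d = 0 <-> exists w, v = w *m e) ->
  A *m d = 0 -> exists w, A = w *m e.
Proof.
move=> ex Ad.
have [|W hW] := @exists_rows R p m (fun i v => row i A = v *m e).
  by move=> i; apply/ex; rewrite -row_mul Ad row0.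
by exists W; apply/row_matrixP => i; rewrite hW row_mul.
Qed.

(** [A] vanishes between distinct degrees, so an entry of [A *m B] in a row of degree [u] sums only
    over middle indices of degree [u]. The corresponding blocks of [A] and [B] therefore multiply to
    an identity matrix, which bounds its size. *)
Lemma card_le_of_mulmx1 (K : fieldType) (T : eqType) (p q : nat)
    (s : 'I_p -> T) (t : 'I_q -> T) (A : 'M[K]_(p, q)) (B : 'M[K]_(q, p))
    (u : T) :
  (forall a b, A a b != 0 -> s a = t b) -> A *m B = 1%:M ->
  (#|[set a | s a == u]| <= #|[set b | t b == u]|)%N.
Proof.
move=> hA AB.
set P := [set a | _]; set Q := [set b | _].
apply: (@mulmx1_min K _ _ (mxsub (@enum_val _ (mem P)) (@enum_val _ (mem Q)) A)
  (mxsub (@enum_val _ (mem Q)) (@enum_val _ (mem P)) B)).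
apply/matrixP => i j; rewrite !mxE.
have -> : (i == j) = (enum_val i == enum_val j).
  by rewrite (inj_eq enum_val_inj).
have /matrixP/(_ (enum_val i) (enum_val j)) := AB.
rewrite !mxE => <-.
rewrite [RHS](bigID (mem Q)) /= [X in _ + X]big1 ?addr0; last first.
  move=> b nb; have [->|/hA E] := eqVneq (A (enum_val i) b) 0.
    by rewrite mul0r.
  by move: nb (enum_valP i); rewrite !inE E => /negbTE->.
by rewrite [RHS]big_enum_val; apply: eq_bigr => k _; rewrite !mxE.
Qed.

Lemma map_mx_mcoeff0M (K : fieldType) (n p q r : nat)
    (A : 'M[{mpoly K[n]}]_(p, q)) (B : 'M[{mpoly K[n]}]_(q, r)) :
  map_mx (mcoeff 0%MM) (A *m B) =
  map_mx (mcoeff 0%MM) A *m map_mx (mcoeff 0%MM) B.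
Proof. exact: map_mxM. Qed.

(** * Lifting through a resolution *)

Lemma multihomogeneous_aug (K : fieldType) (n : nat) (F : free_seq K n) :
  multihomogeneous F -> mhom_mx (@shift _ _ F 0) (fun=> 0%MM) (aug F).
Proof.
by move=> [h _] i b c; rewrite (ord1 b) => /h ->; rewrite addmC add0m.
Qed.

Lemma multihomogeneous_diff (K : fieldType) (n : nat) (F : free_seq K n) j :
  multihomogeneous F -> mhom_mx (@shift _ _ F j.+1) (@shift _ _ F j) (diff F j).
Proof. by move=> [_ h] a b c; exact: h. Qed.

Lemma resolves_diffM (K : fieldType) (n : nat) (I : {mpoly K[n]} -> Prop)
    (F : free_seq K n) j : resolves I F -> diff F j.+1 *m diff F j = 0.
Proof.
move=> [_ _ ex]; apply/row_matrixP => i; rewrite row_mul row0.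
by apply/ex; exists (delta_mx ord0 i); rewrite rowE.
Qed.

Lemma resolves_lift (K : fieldType) (n p : nat) (I : {mpoly K[n]} -> Prop)
    (F : free_seq K n) j (A : 'M_(p, rk F j.+1)) :
  resolves I F -> A *m diff F j = 0 -> exists w, A = w *m diff F j.+1.
Proof. by move=> [_ _ ex]; apply: mx_lift. Qed.

Lemma resolves_lift0 (K : fieldType) (n p : nat) (I : {mpoly K[n]} -> Prop)
    (F : free_seq K n) (A : 'M_(p, rk F 0)) :
  resolves I F -> (forall i, I ((A *m aug F) i ord0)) ->
  exists w, A = w *m diff F 0.
Proof.
move=> [_ ex _] IA.
have [|W hW] := @exists_rows _ p _ (fun i v => row i A = v *m diff F 0).
  by move=> i; apply/ex; rewrite -row_mul mxE.
by exists W; apply/row_matrixP => i; rewrite hW row_mul.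
Qed.

Lemma minimal_diff0 (K : fieldType) (n : nat) (F : free_seq K n) j :
  minimal F -> map_mx (mcoeff 0%MM) (diff F j) = 0.
Proof. by move=> h; apply/matrixP => a b; rewrite !mxE h. Qed.

Lemma resolves_diff0_aug (K : fieldType) (n : nat) (I : {mpoly K[n]} -> Prop)
    (F : free_seq K n) i : resolves I F -> I ((diff F 0 *m aug F) i ord0).
Proof.
move=> [_ ex _].
have := (ex (row i (diff F 0))).2; rewrite -row_mul mxE; apply.
by exists (delta_mx ord0 i); rewrite -rowE.
Qed.

(** * Independence of Betti numbers from the minimal resolution *)

(* The part of a homotopy equivalence that lives in degree [j], in a form that
   can be lifted to degree [j.+1] without choosing whole chain maps. *)
Definition comparison (K : fieldType) (n : nat) (F G : free_seq K n) (j : nat)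
    (f : 'M[{mpoly K[n]}]_(rk F j, rk G j))
    (g : 'M[{mpoly K[n]}]_(rk G j, rk F j))
    (h : 'M[{mpoly K[n]}]_(rk F j, rk F j.+1)) : Prop :=
  [/\ mhom_mx (@shift _ _ F j) (@shift _ _ G j) f,
      exists w, diff F j *m f = w *m diff G j,
      exists w, diff G j *m g = w *m diff F j,
      diff F j *m (f *m g - 1%:M - h *m diff F j) = 0
    & map_mx (mcoeff 0%MM) (f *m g) = 1%:M].

(** Both augmentations are onto S/I, so each factors through the other modulo [I]. Then [f *m g - 1]
    maps into [I], hence factors through [diff F 0], whose entries have no constant term. *)
Lemma comparison0 (K : fieldType) (n : nat) (I : {mpoly K[n]} -> Prop)
    (F G : free_seq K n) :
  monomial_ideal I -> minimal_free_resolution I F ->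
  minimal_free_resolution I G -> exists f g h, @comparison K n F G 0 f g h.
Proof.
move=> hI [homF resF minF] [homG resG minG].
have cover (F1 G1 : free_seq K n) : resolves I G1 -> exists f,
    forall i, I ((aug F1 - f *m aug G1) i ord0).
  move=> [sur _ _].
  have [|f hf] := @exists_rows _ (rk F1 0) (rk G1 0)
      (fun i v => I (aug F1 i ord0 - (v *m aug G1) ord0 ord0)).
    by move=> i; exact: sur.
  by exists f => i; have := hf i; rewrite -row_mul !mxE.
have [f0 hf0] := cover F G resG.
have [g hg] := cover G F resF.
(* Projecting preserves the congruence modulo [I], since both augmentations are homogeneous and [I]
   contains the components of its elements. Only [f] is made homogeneous: its entries are the ones
   that compare degrees. *)
pose f := hpartmx (@shift _ _ F 0) (@shift _ _ G 0) f0.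
have hf i : I ((aug F - f *m aug G) i ord0).
  rewrite -(hpartmxM _ _ (multihomogeneous_aug homG)).
  rewrite -(hpartmx_id (multihomogeneous_aug homF)).
  have := hpart_ideal (shift i) 0%MM hI (hf0 i).
  have -> : (aug F - f0 *m aug G) i ord0 =
    aug F i ord0 - (f0 *m aug G) i ord0 by rewrite !mxE.
  by rewrite hpartB !mxE.
have lifts (F1 G1 : free_seq K n) f1 : resolves I F1 -> resolves I G1 ->
    (forall i, I ((aug F1 - f1 *m aug G1) i ord0)) ->
    exists w, diff F1 0 *m f1 = w *m diff G1 0.
  move=> resF1 resG1 hf1; apply: (@resolves_lift0 _ _ _ I) => // i.
  have -> : diff F1 0 *m f1 *m aug G1 =
      diff F1 0 *m aug F1 - diff F1 0 *m (aug F1 - f1 *m aug G1).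
    by rewrite mulmxBr mulmxA opprB addrCA subrr addr0.
  rewrite mxE; apply: monomial_idealD => //; first exact: resolves_diff0_aug.
  rewrite mxE; apply: monomial_idealN => //; rewrite mxE.
  by apply: monomial_ideal_sum => // k; apply: monomial_idealM.
have [h Eh] : exists h, f *m g - 1%:M = h *m diff F 0.
  apply: (@resolves_lift0 _ _ _ I) => // i.
  have -> : (f *m g - 1%:M) *m aug F =
      - (aug F - f *m aug G) - f *m (aug G - g *m aug F).
    rewrite mulmxBl mul1mx mulmxBr mulmxA !opprB.
    by rewrite [RHS]addrC addrA subrK.
  rewrite mxE; apply: monomial_idealD => //.
    by rewrite mxE; apply: monomial_idealN.
  rewrite mxE; apply: monomial_idealN => //; rewrite mxE.
  by apply: monomial_ideal_sum => // k; apply: monomial_idealM.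
exists f, g, h; split.
- exact: hpartmx_hom.
- exact: lifts.
- exact: lifts.
- by rewrite Eh subrr mulmx0.
rewrite -[f *m g](subrK 1%:M) Eh map_mxD map_mx_mcoeff0M minimal_diff0 //.
by rewrite mulmx0 add0r map_mx1.
Qed.

(** The usual homotopy step: [f' *m g' - 1 - diff F j *m h] is killed by [diff F j], so it equals
    [h' *m diff F j.+1]. Modulo the variables both terms containing a differential vanish, which
    leaves [f' *m g' = 1]. *)
Lemma comparisonS (K : fieldType) (n : nat) (I : {mpoly K[n]} -> Prop)
    (F G : free_seq K n) j f g h :
  minimal_free_resolution I F -> minimal_free_resolution I G ->
  @comparison K n F G j f g h ->
  exists f' g' h', @comparison K n F G j.+1 f' g' h'.
Proof.
move=> [homF resF minF] [homG resG minG] [hf [w0 Ew0] [g' Eg] Eh _].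
pose f' := hpartmx (@shift _ _ F j.+1) (@shift _ _ G j.+1) w0.
have Ef : diff F j *m f = f' *m diff G j.
  rewrite -(hpartmxM _ _ (multihomogeneous_diff homG)) -Ew0 hpartmx_id //.
  exact: (mhom_mxM (multihomogeneous_diff homF) hf).
have [h' Eh'] : exists h', f' *m g' - 1%:M - diff F j *m h = h' *m diff F j.+1.
  apply: (resolves_lift resF).
  rewrite -[RHS]Eh !mulmxBl !mulmxBr mul1mx mulmx1.
  by rewrite -[f' *m g' *m _]mulmxA -Eg mulmxA -Ef !mulmxA.
exists f', g', h'; split.
- exact: hpartmx_hom.
- apply: (resolves_lift resG).
  by rewrite -mulmxA -Ef mulmxA (resolves_diffM _ resF) mul0mx.
- apply: (resolves_lift resF).
  by rewrite -mulmxA -Eg mulmxA (resolves_diffM _ resG) mul0mx.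
- rewrite -Eh' opprB addrCA subrr addr0 mulmxA.
  by rewrite (resolves_diffM _ resF) mul0mx.
have -> : f' *m g' = h' *m diff F j.+1 + diff F j *m h + 1%:M.
  by rewrite -Eh' !subrK.
rewrite !map_mxD !map_mx_mcoeff0M !minimal_diff0 //.
by rewrite mulmx0 mul0mx !add0r map_mx1.
Qed.

(** A nonzero constant entry of the homogeneous map [f] joins basis vectors of equal multidegree, so
    the constant terms of [f] and [g] satisfy the rank bound for graded matrices. *)
Lemma mbetti_le (K : fieldType) (n : nat) (I : {mpoly K[n]} -> Prop)
    (F G : free_seq K n) j u :
  monomial_ideal I -> minimal_free_resolution I F ->
  minimal_free_resolution I G -> (mbetti F j u <= mbetti G j u)%N.
Proof.
move=> hI hF hG.
have [f [g [h [hf _ _ _ fg]]]] : exists f g h, @comparison K n F G j f g h.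
  elim: j => [|j [f [g [h fgh]]]]; first exact: comparison0 hI hF hG.
  exact: comparisonS hF hG fgh.
apply: (card_le_of_mulmx1 (A := map_mx (mcoeff 0%MM) f)
  (B := map_mx (mcoeff 0%MM) g)); last by rewrite -map_mx_mcoeff0M.
by move=> a b; rewrite mxE -mcoeff_msupp => /hf <-; rewrite add0m.
Qed.

Lemma mbetti_unique (K : fieldType) (n : nat) (I : {mpoly K[n]} -> Prop)
    (F G : free_seq K n) j u :
  monomial_ideal I -> minimal_free_resolution I F ->
  minimal_free_resolution I G -> mbetti F j u = mbetti G j u.
Proof.
by move=> hI hF hG; apply/eqP; rewrite eqn_leq !(mbetti_le _ _ hI).
Qed.

(** * The modules F_0 and F_1 of a minimal resolution *)

Lemma mcoeff0M (K : fieldType) (n : nat) (p q : {mpoly K[n]}) :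
  (p * q)@_0%MM = p@_0%MM * q@_0%MM.
Proof. exact: rmorphM. Qed.

Lemma mcoeff0_proper (K : fieldType) (n : nat) (I : {mpoly K[n]} -> Prop)
    (f : {mpoly K[n]}) :
  monomial_ideal I -> ~ I 1 -> I f -> f@_0%MM = 0.
Proof.
move=> hI nI1 /(monomial_idealP hI) If; apply: memN_msupp_eq0.
by apply/negP => /If; rewrite mpolyX0.
Qed.

(** F_0 is S itself. Since 1 is reached modulo the proper ideal [I], some entry of [aug F] has a
    nonzero constant term; homogeneity makes it a constant of multidegree 0. *)
Lemma resolves_aug (K : fieldType) (n : nat) (I : {mpoly K[n]} -> Prop)
    (F : free_seq K n) :
  monomial_ideal I -> ~ I 1 -> minimal_free_resolution I F ->
  exists (i0 : 'I_(rk F 0)) (x : K),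
    [/\ x != 0,
        forall v : 'rV_(rk F 0), (v *m aug F) ord0 ord0 = x *: v ord0 i0,
        shift i0 = 0%MM & forall k, k = i0].
Proof.
move=> hI nI1 [homF resF minF]; have [sur ex _] := resF.
have [v Iv] := sur 1.
have [i0 xi0] : exists i0, (aug F i0 ord0)@_0%MM != 0.
  have [/existsP //|/existsPn h] := boolP [exists i, (aug F i ord0)@_0%MM != 0].
  have /eqP := mcoeff0_proper hI nI1 Iv.
  rewrite mcoeffB mcoeff1 eqxx mxE raddf_sum big1 ?subr0 ?oner_eq0 //.
  move=> i _; rewrite /= mcoeff0M.
  by move: (h i); rewrite negbK => /eqP->; rewrite mulr0.
set x := _@_0%MM in xi0.
have si0 : shift i0 = 0%MM by apply/esym/(homF.1 i0); rewrite mcoeff_msupp.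
have augi0 : aug F i0 ord0 = x%:MP.
  apply/mpolyP => c; rewrite mcoeffC.
  have [->|c0] := eqVneq c 0%MM; first by rewrite mulr1.
  rewrite mulr0; apply: memN_msupp_eq0.
  by apply: contra c0 => /homF.1 ->; rewrite si0.
have i0E k : k = i0.
  apply/eqP/negPn/negP => ki0.
  (* A kernel vector of the augmentation with coordinate 1 at [k], which minimality forbids. *)
  pose v1 : 'rV_(rk F 0) :=
    delta_mx ord0 k - (x^-1 *: aug F k ord0) *: delta_mx ord0 i0.
  have /ex[w Ew] : I ((v1 *m aug F) ord0 ord0).
    rewrite mulmxBl -scalemxAl -!rowE 4!mxE mxE augi0 mulrC mul_mpolyC scalerA.
    by rewrite mulfV // scale1r subrr; exact: monomial_ideal0.
  have := congr1 (fun A : 'rV_(rk F 0) => (A ord0 k)@_0%MM) Ew.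
  rewrite !mxE !eqxx (negbTE ki0) mulr0 subr0 mcoeff1 eqxx raddf_sum big1.
    by move/eqP; rewrite oner_eq0.
  by move=> i _; rewrite /= mcoeff0M minF mulr0.
exists i0, x; split=> // u.
rewrite mxE (bigD1 i0) //= big1 ?addr0 => [|k]; last by rewrite (i0E k) eqxx.
by rewrite augi0 mulrC mul_mpolyC.
Qed.

Lemma resolves_ideal (K : fieldType) (n : nat) (I : {mpoly K[n]} -> Prop)
    (F : free_seq K n) (i0 : 'I_(rk F 0)) (x : K) :
  monomial_ideal I -> resolves I F -> x != 0 ->
  (forall v : 'rV_(rk F 0), (v *m aug F) ord0 ord0 = x *: v ord0 i0) ->
  (forall k, k = i0) ->
  forall f, I f <-> exists w : 'rV_(rk F 1), f = (w *m diff F 0) ord0 i0.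
Proof.
move=> hI [_ ex _] x0 augE i0E f; split=> [If|[w ->]].
  have [|w Ew] := (ex (f *: delta_mx ord0 i0)).1.
    by rewrite augE -mul_mpolyC; apply: monomial_idealM;
      rewrite // !mxE !eqxx mulr1.
  by exists w; rewrite -Ew !mxE !eqxx mulr1.
have /ex : exists w', w *m diff F 0 = w' *m diff F 0 by exists w.
rewrite augE => /(monomial_idealM (x^-1)%:MP hI).
by rewrite mul_mpolyC scalerA mulVf // scale1r.
Qed.

(** Minimality in the form used below: a kernel vector is a boundary, so it has no coordinate with a
    constant term. *)
Lemma minimal_kernel (K : fieldType) (n : nat) (I : {mpoly K[n]} -> Prop)
    (F : free_seq K n) j (v : 'rV_(rk F j.+1)) a :
  minimal_free_resolution I F -> v *m diff F j = 0 -> (v ord0 a)@_0%MM = 0.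
Proof.
move=> [_ [_ _ ex] minF] /ex[w ->].
rewrite mxE raddf_sum big1 // => i _.
by rewrite /= mcoeff0M minF mulr0.
Qed.

(** Homogeneity leaves only a scalar multiple of x^(shift a); were it 0, the basis vector [a] would
    lie in the kernel, against minimality. *)
Lemma resolves_diff0 (K : fieldType) (n : nat) (I : {mpoly K[n]} -> Prop)
    (F : free_seq K n) (i0 : 'I_(rk F 0)) a :
  minimal_free_resolution I F -> shift i0 = 0%MM -> (forall k, k = i0) ->
  exists2 y, y != 0 & diff F 0 a i0 = y *: 'X_[shift a].
Proof.
move=> hF si0 i0E; have [homF resF minF] := hF.
have [E|[k [y [Ek y0 E]]]] := mhomP (homF.2 0%N a i0); last first.
  by exists y; rewrite // E -Ek si0 addm0.
have /eqP : ((delta_mx ord0 a : 'rV[{mpoly K[n]}]_(rk F 1)) ord0 a)@_0%MM = 0.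
  apply: (minimal_kernel _ hF); rewrite -rowE.
  by apply/rowP => k; rewrite !mxE (i0E k) E.
by rewrite mxE !eqxx mcoeff1 eqxx oner_eq0.
Qed.

(** Two basis vectors of the same multidegree would have proportional images, giving a kernel vector
    with a unit coordinate. *)
Lemma shift1_inj (K : fieldType) (n : nat) (I : {mpoly K[n]} -> Prop)
    (F : free_seq K n) (i0 : 'I_(rk F 0)) :
  minimal_free_resolution I F -> shift i0 = 0%MM -> (forall k, k = i0) ->
  injective (@shift _ _ F 1).
Proof.
move=> hF si0 i0E a b sab; apply/eqP/negPn/negP => nab.
have [y y0 Ey] := resolves_diff0 a hF si0 i0E.
have [z z0 Ez] := resolves_diff0 b hF si0 i0E.
pose v : 'rV[{mpoly K[n]}]_(rk F 1) :=
  z%:MP *: delta_mx ord0 a - y%:MP *: delta_mx ord0 b.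
have /eqP : (v ord0 a)@_0%MM = 0.
  apply: (minimal_kernel _ hF); rewrite mulmxBl -!scalemxAl -!rowE.
  apply/rowP => k; rewrite !mxE (i0E k) Ey Ez sab !mul_mpolyC !scalerA.
  by rewrite mulrC subrr.
rewrite !mxE !eqxx (negbTE nab) mulr0 subr0 mulr1 mcoeffC eqxx mulr1.
by rewrite (negbTE z0).
Qed.

Lemma shift1_ideal (K : fieldType) (n : nat) (I : {mpoly K[n]} -> Prop)
    (F : free_seq K n) (a : 'I_(rk F 1)) :
  monomial_ideal I -> ~ I 1 -> minimal_free_resolution I F -> I 'X_[shift a].
Proof.
move=> hI nI1 hF.
have [i0 [x [x0 augE si0 i0E]]] := resolves_aug hI nI1 hF.
have [y y0 Ey] := resolves_diff0 a hF si0 i0E.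
have [_ resF _] := hF.
apply/(resolves_ideal hI resF x0 augE i0E).
exists (y^-1%:MP *: delta_mx ord0 a).
by rewrite -scalemxAl -rowE !mxE Ey mul_mpolyC scalerA mulVf // scale1r.
Qed.

Lemma MinGens_ideal (K : fieldType) (n : nat) (I : {mpoly K[n]} -> Prop)
    (c : 'X_{1..n}) : MinGens I c -> I 'X_[c].
Proof.
move=> [G [[genG _] Gc]]; apply/genG/ideal_genP => d.
by rewrite msuppX inE => /eqP->; exists c; split=> //; exact: lepm_refl.
Qed.

Lemma MinGens_minimal (K : fieldType) (n : nat) (I : {mpoly K[n]} -> Prop)
    (c d : 'X_{1..n}) :
  MinGens I c -> I 'X_[d] -> (d <= c)%MM -> d = c.
Proof.
move=> [G [[genG minG] Gc]] /genG/ideal_genP Id dc.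
have [|e [Ge ed]] := Id d; first by rewrite msuppX inE.
have [ec|/eqP ec] := eqVneq e c.
  rewrite ec in ed; apply/mnmP => i; apply/eqP; rewrite eqn_leq.
  by rewrite (mnm_lepP dc) (mnm_lepP ed).
(* Here [e] is a generator other than [c] that divides [c], so [G] without [c] still generates [I],
   against the minimality of [G]. *)
have [] // : G c /\ c <> c.
apply: (minG (fun m => G m /\ m <> c)) => // [m []//|f].
split=> [/genG/ideal_genP If|/ideal_genP If].
  apply/ideal_genP => m /If[k [Gk km]].
  have [kc|/eqP kc] := eqVneq k c; last by exists k.
  exists e; split=> //; apply: lepm_trans km; rewrite kc.
  exact: lepm_trans dc.
by apply/genG/ideal_genP => m /If[k [[Gk _] km]]; exists k.
Qed.

(** x^c is a combination of the entries of [diff F 0], so some x^(shift a) in [I] divides it;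
    minimality of [c] gives equality. *)
Lemma MinGens_shift (K : fieldType) (n : nat) (I : {mpoly K[n]} -> Prop)
    (F : free_seq K n) (c : 'X_{1..n}) :
  monomial_ideal I -> ~ I 1 -> minimal_free_resolution I F -> MinGens I c ->
  exists a : 'I_(rk F 1), shift a = c.
Proof.
move=> hI nI1 hF hc.
have [i0 [x [x0 augE si0 i0E]]] := resolves_aug hI nI1 hF.
have IE := resolves_ideal hI (let: And3 _ r _ := hF in r) x0 augE i0E.
have [w Ew] := (IE _).1 (MinGens_ideal hc).
have : 'X_[c]@_c != 0 :> K by rewrite mcoeffX eqxx oner_eq0.
rewrite Ew mxE raddf_sum /= => nz.
have [a ca] : exists a, (w ord0 a * diff F 0 a i0)@_c != 0.
  apply/existsP; apply: contraNT nz => /existsPn h.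
  by rewrite big1 // => a _; move: (h a); rewrite negbK => /eqP.
exists a; have [y y0 Ey] := resolves_diff0 a hF si0 i0E.
apply: (MinGens_minimal hc); first exact: (shift1_ideal a hI nI1 hF).
move: ca; rewrite Ey -scalerAr mcoeffZ mulf_eq0 negb_or -mcoeff_msupp.
rewrite (perm_mem (msuppMX _ _)) => /andP[_ /mapP[d _ ->]].
exact: lem_addr.
Qed.

(** * The colon ideal (I : x^mu) *)

Lemma mpolyX_dvd (K : fieldType) (n : nat) (m : 'X_{1..n})
    (f : {mpoly K[n]}) :
  (forall c, c \in msupp f -> (m <= c)%MM) -> exists q, f = q * 'X_[m].
Proof.
move=> hf; exists (\sum_(c <- msupp f) f@_c *: 'X_[c - m]).
rewrite [LHS]mpolyE mulr_suml; apply: eq_big_seq => c /hf mc.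
by rewrite -scalerAl -mpolyXD submK.
Qed.

Lemma gcd_lem (K : fieldType) (n : nat) (I : {mpoly K[n]} -> Prop)
    (g c : 'X_{1..n}) : is_gcd I g -> I 'X_[c] -> (g <= c)%MM.
Proof.
move=> [hg _] /hg[q Eq].
have : c \in msupp ('X_[c] : {mpoly K[n]}) by rewrite msuppX inE.
rewrite Eq (perm_mem (msuppMX _ _)) => /mapP[d _ ->].
exact: lem_addr.
Qed.

(* Every exponent of an element of [I] is at least [g], and [g] agrees with
   [nu] wherever [mu] does not already exceed [nu]; hence (I : mu) is the
   principal ideal of lcm(mu, nu) / mu, whose exponent is the truncated
   [nu - mu]. *)
Lemma Cset_colon (K : fieldType) (n : nat) (I : {mpoly K[n]} -> Prop)
    (g nu mu : 'X_{1..n}) (f : {mpoly K[n]}) :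
  monomial_ideal I -> is_gcd I g -> Cset g nu mu -> I (f * 'X_[mu]) ->
  exists q, f = q * 'X_[nu - mu].
Proof.
move=> hI hg [_ hmu _] /(monomial_idealP hI) If.
apply: mpolyX_dvd => c cf.
have /(gcd_lem hg)/mnm_lepP gc : I 'X_[mu + c].
  by apply: If; rewrite (perm_mem (msuppMX _ _)); apply: map_f.
apply/mnm_lepP => i; rewrite mnmBE leq_subLR.
have [->|/eqP/hmu h] := eqVneq (nu i) (g i); first by rewrite -mnmDE.
exact: leq_trans h (leq_addr _ _).
Qed.

Lemma ideal_addl (K : fieldType) (n : nat) (I : {mpoly K[n]} -> Prop)
    (m : 'X_{1..n}) (f : {mpoly K[n]}) : I f -> ideal_add I m f.
Proof. by move=> If; exists f, 0; rewrite mul0r addr0. Qed.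

Lemma ideal_addr (K : fieldType) (n : nat) (I : {mpoly K[n]} -> Prop)
    (m : 'X_{1..n}) (q : {mpoly K[n]}) :
  monomial_ideal I -> ideal_add I m (q * 'X_[m]).
Proof.
by move=> hI; exists 0, q; rewrite add0r; split=> //; exact: monomial_ideal0.
Qed.

(** * The case where x^mu divides x^nu: replacing a generator *)

(* F with the basis vector [a0] of F_1 put in multidegree [mu]; [D] is meant to
   be diagonal with [D *m d0 = diff F 0]. *)
Definition rescale (K : fieldType) (n : nat) (F : free_seq K n)
    (a0 : 'I_(rk F 1)) (mu : 'X_{1..n}) (d0 : 'M[{mpoly K[n]}]_(rk F 1, rk F 0))
    (D : 'M[{mpoly K[n]}]_(rk F 1)) : free_seq K n :=
  @FreeSeq K n (rk F)
    (fun j => match j return 'I_(rk F j) -> 'X_{1..n} with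
              | 1 => fun a => if a == a0 then mu else shift a
              | _ => @shift _ _ F _
              end)
    (fun j => match j return 'M_(rk F j.+1, rk F j) with
              | 0 => d0
              | 1 => diff F 1 *m D
              | _ => diff F _
              end)
    (aug F).

(** [diff F 0] factors as [D *m d0], where [D] multiplies coordinate [a0] by x^(nu - mu).
    Injectivity of [D] keeps exactness in degree 2; in degree 1 the colon hypothesis puts the kernel
    of [d0] in the image of [D]. *)
Lemma rescale_minimal_free_resolution (K : fieldType) (n : nat)
    (I : {mpoly K[n]} -> Prop) (nu mu : 'X_{1..n}) (F : free_seq K n)
    (a0 : 'I_(rk F 1)) :
  monomial_ideal I -> ~ I 1 -> minimal_free_resolution I F ->
  shift a0 = nu -> mu <> 0%MM -> (mu <= nu)%MM ->
  (forall f, I (f * 'X_[mu]) -> exists q, f = q * 'X_[nu - mu]) ->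
  exists d0 D, minimal_free_resolution (ideal_add I mu) (rescale a0 mu d0 D).
Proof.
move=> hI nI1 hF sa0 mu0 munu colon; have [homF resF minF] := hF.
have [i0 [x [x0 augE si0 i0E]]] := resolves_aug hI nI1 hF.
have IE := resolves_ideal hI resF x0 augE i0E.
have [y y0 Ey] := resolves_diff0 a0 hF si0 i0E.
pose d0 : 'M[{mpoly K[n]}]_(rk F 1, rk F 0) :=
  \matrix_(a, b) if a == a0 then y *: 'X_[mu] else diff F 0 a b.
pose dl : 'rV[{mpoly K[n]}]_(rk F 1) :=
  \row_a if a == a0 then 'X_[nu - mu] else 1.
pose D := diag_mx dl.
have dl0 a : dl ord0 a != 0.
  rewrite mxE; case: ifP => _; last exact: oner_neq0.
  by rewrite -msupp_eq0 msuppX.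
have Dinj (p : nat) (v : 'M_(p, rk F 1)) : v *m D = 0 -> v = 0.
  rewrite mul_mx_diag => /matrixP h; apply/matrixP => i a.
  have := h i a; rewrite mxE [RHS]mxE => /eqP.
  by rewrite mulf_eq0 (negbTE (dl0 a)) orbF mxE => /eqP.
have Dd0 : D *m d0 = diff F 0.
  rewrite mul_diag_mx; apply/matrixP => a b; rewrite !mxE (i0E b).
  case: eqP => [->|_]; last by rewrite mul1r.
  by rewrite Ey -scalerAr -mpolyXD submK // sa0.
have Id a : I (diff F 0 a i0).
  by apply/IE; exists (delta_mx ord0 a); rewrite -rowE mxE.
have ZJ f (z : K) : I f -> I (z *: f).
  by move=> If; rewrite -mul_mpolyC; apply: monomial_idealM.
have Jd0 a : ideal_add I mu (d0 a i0).
  rewrite mxE; case: eqP => _; last exact: ideal_addl.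
  by rewrite -mul_mpolyC; apply: ideal_addr.
(* Isolating the term at [a0] in [v *m d0 = 0] puts [v ord0 a0 * 'X_[mu]] in [I]. *)
have ker0 (v : 'rV_(rk F 1)) : v *m d0 = 0 -> exists w, v = w *m D.
  move=> vd0; have [q Eq] : exists q, v ord0 a0 = q * 'X_[nu - mu].
    apply: colon; rewrite -[X in I X](scalerK y0); apply: ZJ.
    have := congr1 (fun A : 'rV_(rk F 0) => A ord0 i0) vd0.
    rewrite mxE [RHS]mxE (bigD1 a0) //= mxE eqxx -scalerAr => /eqP.
    rewrite addr_eq0 => /eqP->; apply: monomial_idealN => //.
    apply: (big_ind I) => [|f h|a na]; first exact: monomial_ideal0.
      exact: monomial_idealD.
    by rewrite mxE (negbTE na); apply: monomial_idealM.
  exists (\row_a if a == a0 then q else v ord0 a).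
  rewrite mul_mx_diag; apply/rowP => a; rewrite !mxE.
  by case: eqP => [->|_]; rewrite ?mulr1.
exists d0, D; split.
- split; first by case: homF.
  move=> [|[|j]] a b /=; last exact: homF.2.
  + rewrite (i0E b) mxE si0 => c; case: eqP => _.
      exact: ((mhomZX (addm0 mu) : mhom mu 0%MM (y *: 'X_[mu])) c).
    by move=> h; rewrite -si0; apply: (homF.2 0%N) h.
  + rewrite mul_mx_diag mxE => c; rewrite [dl _ _]mxE.
    case: eqP => [->|_]; last by rewrite mulr1; exact: (homF.2 1%N).
    rewrite (perm_mem (msuppMX _ _)) => /mapP[d hd ->].
    transitivity (d + shift a0)%MM; last exact: (homF.2 1%N a a0 d hd).
    by rewrite sa0 -{2}(submK munu) addmA [(d + _)%MM]addmC.
- split.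
  + case: resF => sur _ _ f; have [v Iv] := sur f.
    by exists v; apply: ideal_addl.
  + move=> v /=; rewrite augE; split=> [[f [q [/IE[w ->] E]]]|[w ->]].
      (* The factor [x^-1] undoes the augmentation, and [y^-1] the coefficient of x^mu in [d0]. *)
      exists (x^-1%:MP *: (w *m D + (q * y^-1%:MP) *: delta_mx ord0 a0)).
      apply/rowP => k; rewrite (i0E k) -scalemxAl mulmxDl -mulmxA Dd0 -scalemxAl.
      rewrite -rowE [RHS]mxE [X in _ * X]mxE [X in _ * (_ + X)]mxE [row _ _ _ _]mxE.
      rewrite [d0 _ _]mxE eqxx -mulrA !mul_mpolyC [y^-1 *: _]scalerA mulVf //.
      by rewrite scale1r -E scalerA mulVf // scale1r.
    rewrite -mul_mpolyC; apply: monomial_idealM; first exact: monomial_ideal_add.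
    by apply: monomial_ideal_row => //; exact: monomial_ideal_add.
  + have [_ _ ex] := resF.
    move=> [|[|[|j]]] v /=; last exact: ex.
    * split=> [/[dup] vd0 /ker0[w Ew]|[z ->]].
        have /ex[z Ez] : w *m diff F 0 = 0 by rewrite -Dd0 mulmxA -Ew.
        by exists z; rewrite mulmxA -Ez.
      by rewrite -mulmxA -[_ *m d0]mulmxA Dd0 (resolves_diffM _ resF) mulmx0.
    * rewrite mulmxA; split=> [/Dinj/ex //|/ex ->]; exact: mul0mx.
    * exact: ex.
- move=> [|[|j]] a b /=; last exact: minF.
  + rewrite mxE; case: eqP => _; last exact: minF.
    rewrite mcoeffZ mcoeffX; case: eqP => [//|_]; exact: mulr0.
  + by rewrite mul_mx_diag mxE mcoeff0M minF mul0r.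
Qed.

(** * The case where x^mu does not divide x^nu: the mapping cone *)

Definition cone_rk (K : fieldType) (n : nat) (F : free_seq K n) (j : nat) :
    nat :=
  match j with 1 => rk F 1 + 1 | 2 => rk F 2 + 1 | _ => rk F j end.

(* The mapping cone of multiplication by x^mu from S/(I : mu), resolved by
   [0 -> S -> S], to S/I. *)
Definition cone (K : fieldType) (n : nat) (F : free_seq K n)
    (mu lam : 'X_{1..n}) (d0 : 'rV[{mpoly K[n]}]_(rk F 0))
    (d1 : 'rV[{mpoly K[n]}]_(rk F 1)) (x : {mpoly K[n]}) : free_seq K n :=
  @FreeSeq K n (cone_rk F)
    (fun j => match j return 'I_(cone_rk F j) -> 'X_{1..n} with
              | 1 => fun a => match split a with
                              | inl b => shift b
                              | inr _ => mu
                              end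
              | 2 => fun a => match split a with
                              | inl b => shift b
                              | inr _ => lam
                              end
              | _ => @shift _ _ F _
              end)
    (fun j => match j return 'M_(cone_rk F j.+1, cone_rk F j) with
              | 0 => col_mx (diff F 0) d0
              | 1 => block_mx (diff F 1) 0 d1 x%:M
              | 2 => row_mx (diff F 2) 0
              | _ => diff F _
              end)
    (aug F).

(** The colon hypothesis gives exactness in degree 1, and x^(nu - mu) being a nonzerodivisor gives
    it in degree 2. The cone is minimal because neither of x^mu, x^nu divides the other, so x^(nu -
    mu) and x^(mu - nu) are both different from 1. *)
Lemma cone_minimal_free_resolution (K : fieldType) (n : nat)
    (I : {mpoly K[n]} -> Prop) (nu mu : 'X_{1..n}) (F : free_seq K n)
    (a0 : 'I_(rk F 1)) :
  monomial_ideal I -> ~ I 1 -> minimal_free_resolution I F ->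
  shift a0 = nu -> mu <> 0%MM -> ~~ (mu <= nu)%MM -> ~~ (nu <= mu)%MM ->
  (forall f, I (f * 'X_[mu]) -> exists q, f = q * 'X_[nu - mu]) ->
  exists d0 d1 x,
    minimal_free_resolution (ideal_add I mu)
      (@cone K n F mu (mlcm mu nu) d0 d1 x).
Proof.
move=> hI nI1 hF sa0 mu0 nmunu nnumu colon; have [homF resF minF] := hF.
have [i0 [x [x0 augE si0 i0E]]] := resolves_aug hI nI1 hF.
have IE := resolves_ideal hI resF x0 augE i0E.
have [y y0 Ey] := resolves_diff0 a0 hF si0 i0E.
(* Subtraction of exponents is truncated, so these differences are the exponents of lcm/x^mu and
   lcm/x^nu. *)
have numuE : (nu - mu + mu)%MM = mlcm mu nu by rewrite mlcmE addmC.
have munuE : (mu - nu + nu)%MM = mlcm mu nu by rewrite mlcmC mlcmE addmC.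
pose d0 : 'rV[{mpoly K[n]}]_(rk F 0) := const_mx 'X_[mu].
(* Up to sign, the lift of x^(nu - mu) x^mu = x^(mu - nu) x^nu through [diff F 0], whose row [a0] is
   y x^nu. *)
pose d1 : 'rV[{mpoly K[n]}]_(rk F 1) :=
  (- y^-1 *: 'X_[mu - nu]) *: delta_mx ord0 a0.
have d1d0 : d1 *m diff F 0 + 'X_[nu - mu] *: d0 = 0.
  apply/rowP => k; rewrite (i0E k) -scalemxAl -rowE !mxE Ey -scalerAl -scalerAr.
  by rewrite scalerA mulNr mulVf // scaleN1r -!mpolyXD sa0 munuE numuE addNr.
have [_ _ ex] := resF.
have dd j := resolves_diffM j resF.
have row1 (M : 'M[{mpoly K[n]}]_1) : M = (M ord0 ord0)%:M.
  by rewrite [LHS]mx11_scalar.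
exists d0, d1, 'X_[nu - mu]; split.
- split; first by case: homF.
  move=> [|[|[|j]]] a b c /=; last exact: homF.2.
  + rewrite mxE; case: (split a) => [a'|a']; first exact: (homF.2 0%N).
    by rewrite mxE msuppX inE => /eqP->; rewrite (i0E b) si0 addm0.
  + rewrite mxE; case: (split a) => a'; rewrite mxE; case: (split b) => b'.
    * exact: (homF.2 1%N).
    * by rewrite mxE msupp0.
    * rewrite !mxE (ord1 a') eqxx /=; case: eqP => [->|_]; last first.
        by rewrite mulr0 msupp0.
      by rewrite mulr1 => /msuppZ_le; rewrite msuppX inE sa0 => /eqP->.
    * by rewrite mxE (ord1 a') (ord1 b') eqxx mulr1n msuppX inE => /eqP->.
  + rewrite mxE; case: (split b) => b'; first exact: (homF.2 2%N).
    by rewrite mxE msupp0.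
- split.
  + case: resF => sur _ _ f; have [v Iv] := sur f.
    by exists v; apply: ideal_addl.
  + move=> v /=; rewrite augE; split=> [[f [q [/IE[w ->] E]]]|[w ->]].
      exists (x^-1%:MP *: row_mx w q%:M).
      apply/rowP => k; rewrite (i0E k) -scalemxAl mul_row_col mul_scalar_mx.
      rewrite [RHS]mxE [X in _ * X]mxE [X in _ * (_ + X)]mxE [d0 _ _]mxE -E.
      by rewrite mul_mpolyC scalerA mulVf // scale1r.
    have hJ := monomial_ideal_add mu hI.
    rewrite -mul_mpolyC; apply: monomial_idealM => //.
    apply: monomial_ideal_row => // a; rewrite mxE.
    case: (split a) => a'; last by rewrite mxE -['X_[mu]]mul1r; exact: ideal_addr.
    by apply/ideal_addl/IE; exists (delta_mx ord0 a'); rewrite -rowE mxE.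
  + move=> [|[|[|j]]] v /=; last exact: ex.
    * rewrite -[v]hsubmxK mul_row_col (row1 (rsubmx v)) mul_scalar_mx.
      set v1 := lsubmx v; set q := rsubmx v ord0 ord0.
      split=> [vd0|[z Ez]].
        have [w Ew] : exists w, q = w * 'X_[nu - mu].
          apply: colon; have /IE : exists w : 'rV_(rk F 1),
            - (q * 'X_[mu]) = (w *m diff F 0) ord0 i0.
            exists v1; apply/esym/eqP; rewrite -addr_eq0.
            have := congr1 (fun A : 'rV_(rk F 0) => A ord0 i0) vd0.
            by rewrite mxE [X in _ + X]mxE [d0 _ _]mxE [RHS]mxE => ->.
          by move/(monomial_idealN hI); rewrite opprK.
        (* Subtracting [w] times the new row of the differential from degree 2 leaves a cycle of
           [F]. *)
        have /ex[z Ez] : (v1 - w *: d1) *m diff F 0 = 0.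
          rewrite mulmxBl -scalemxAl.
          move/eqP: d1d0; rewrite addr_eq0 => /eqP->.
          by rewrite scalerN opprK scalerA -Ew.
        exists (row_mx z w%:M); rewrite mul_row_block mulmx0 add0r -Ez.
        by rewrite mul_scalar_mx subrK -scalar_mxM -Ew.
      have : row_mx v1 q%:M *m col_mx (diff F 0) d0 = 0.
        rewrite Ez -mulmxA mul_block_col dd mul0mx addr0 mul_scalar_mx.
        by rewrite d1d0 col_mx0 mulmx0.
      by rewrite mul_row_col mul_scalar_mx.
    * rewrite -[v]hsubmxK mul_row_block (row1 (rsubmx v)) mulmx0 add0r.
      set v1 := lsubmx v; set q := rsubmx v ord0 ord0.
      rewrite -scalar_mxM -row_mx0; split=> [/eq_row_mx[v1d1 /matrixP q0]|[z]].
        (* The new coordinate of a cycle vanishes, so the cycle already lives in [F]. *)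
        have /eqP : q * 'X_[nu - mu] = 0.
          by have := q0 ord0 ord0; rewrite !mxE eqxx mulr1n.
        rewrite mulf_eq0 -[X in _ || X]msupp_eq0 msuppX orbF => /eqP q_eq0.
        move: v1d1; rewrite q_eq0 raddf0 mul0mx addr0 => /ex[z Ez].
        by exists z; rewrite mul_mx_row mulmx0 -Ez.
      rewrite mul_mx_row mulmx0 => /eq_row_mx[-> q0].
      by rewrite scalar_mxM q0 !mul0mx addr0 -mulmxA dd mulmx0.
    * rewrite mul_mx_row mulmx0 -row_mx0; split=> [/eq_row_mx[/ex]//|/ex->//].
- move=> [|[|[|j]]] a b /=; last exact: minF.
  + rewrite mxE; case: (split a) => a'; first exact: minF.
    rewrite mxE mcoeffX; case: eqP => //.
  + rewrite mxE; case: (split a) => a'; rewrite mxE; case: (split b) => b'.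
    * exact: minF.
    * by rewrite mxE mcoeff0.
    * rewrite !mxE mcoeff0M mcoeffZ mcoeffX; case: eqP => [E|_].
        case/negP: nmunu; move: munuE; rewrite E add0m => ->; exact: lem_mlcml.
      by rewrite mulr0 mul0r.
    * rewrite mxE; case: eqP => _; rewrite ?mulr0n ?mcoeff0 //.
      rewrite mulr1n mcoeffX; case: eqP => [E|//].
      case/negP: nnumu; move: numuE; rewrite E add0m => ->; exact: lem_mlcmr.
  + rewrite mxE; case: (split b) => b'; first exact: minF.
    by rewrite mxE mcoeff0.
Qed.

(** * Counting basis vectors by multidegree *)

Lemma card_set_sum (T : finType) (P : pred T) :
  #|[set a | P a]| = (\sum_a P a)%N.
Proof. by rewrite cardsE -sum1_card big_mkcond. Qed.

(** Equal fibres make the two lists of values permutations of each other. Multigraded Betti numbers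
    thus determine the graded and total ones. *)
Lemma card_fibers_eq (T : eqType) (p q : nat) (s : 'I_p -> T) (t : 'I_q -> T)
    (P : pred T) :
  (forall u, #|[set a | s a == u]| = #|[set b | t b == u]|) ->
  #|[set a | P (s a)]| = #|[set b | P (t b)]|.
Proof.
have countE r (w : 'I_r -> T) Q : #|[set a | Q (w a)]| = count Q (codom w).
  rewrite count_map card_set_sum -sum1_count big_enum_cond /=.
  by rewrite [RHS]big_mkcond.
move=> h; rewrite !countE; apply/permP/allP => u _ /=.
by rewrite -!(countE _ _ (pred1 u)) h.
Qed.

Lemma card_shift_unique (K : fieldType) (n : nat) (I : {mpoly K[n]} -> Prop)
    (F G : free_seq K n) j (P : pred 'X_{1..n}) :
  monomial_ideal I -> minimal_free_resolution I F ->
  minimal_free_resolution I G ->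
  #|[set i : 'I_(rk F j) | P (shift i)]| =
  #|[set i : 'I_(rk G j) | P (shift i)]|.
Proof.
by move=> hI hF hG; apply: card_fibers_eq => u;
   exact: (mbetti_unique j u hI hF hG).
Qed.

(** The lost vector is added on the left to avoid truncated subtraction. The predicate [P] covers
    multigraded, graded and total counts at once. *)
Lemma card_shift_rescale (K : fieldType) (n : nat) (F : free_seq K n)
    (a0 : 'I_(rk F 1)) (mu : 'X_{1..n}) d0 D j (P : pred 'X_{1..n}) :
  (#|[set i : 'I_(rk (rescale a0 mu d0 D) j) | P (shift i)]|
     + (j == 1) * P (shift a0) =
   #|[set i : 'I_(rk F j) | P (shift i)]| + (j == 1) * P mu)%N.
Proof.
case: j => [|[|j]] //; rewrite !card_set_sum /= !mul1n.
rewrite (bigD1 a0) //= eqxx [X in _ = (X + _)%N](bigD1 a0) //=.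
rewrite addnAC [RHS]addnAC; congr (_ + _)%N; first exact: addnC.
by apply: eq_bigr => i /negbTE->.
Qed.

Lemma card_shift_cone (K : fieldType) (n : nat) (F : free_seq K n)
    (mu lam : 'X_{1..n}) d0 d1 x j (P : pred 'X_{1..n}) :
  #|[set i : 'I_(rk (@cone K n F mu lam d0 d1 x) j) | P (shift i)]| =
  (#|[set i : 'I_(rk F j) | P (shift i)]| + (j == 1) * P mu
     + (j == 2) * P lam)%N.
Proof.
case: j => [|[|[|j]]] /=; rewrite ?addn0 // !card_set_sum /= !mul1n ?mul0n ?addn0.
all: rewrite big_split_ord big_ord1 /=; congr (_ + _)%N.
all: rewrite ?(unsplitK (inr _)) //.
all: by apply: eq_bigr => i _; rewrite (unsplitK (inl _)).
Qed.

Lemma mdeg_lt (n : nat) (c d : 'X_{1..n}) :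
  (c <= d)%MM -> c != d -> (mdeg c < mdeg d)%N.
Proof.
move=> cd; rewrite -{1 2}(submK cd) mdegD -[X in (X < _)%N]add0n ltn_add2r lt0n.
by rewrite mdeg_eq0; apply: contraNN => /eqP->; rewrite add0m.
Qed.

Theorem theorem5p1 (K : fieldType) (n : nat) (I : {mpoly K[n]} -> Prop)
    (g nu mu : 'X_{1..n}) (F F' : free_seq K n) (j : nat)
    (hI : monomial_ideal I)
    (hg : is_gcd I g) (hg1 : g <> 0%MM)
    (hnu : MinGens I nu) (hmu : Cset g nu mu)
    (hF : minimal_free_resolution I F)
    (hF' : minimal_free_resolution (ideal_add I mu) F')
    (hj : (0 < j)%N) :
  [/\ forall u : 'X_{1..n}, u <> 0%MM -> lcm_lattice (ideal_add I mu) u ->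
        mbetti F' j u =
          if (j == 1)%N && (u == mu) then 1%N
          else if [&& (j == 1)%N, u == nu & (mu <= nu)%MM] then 0%N
          else if [&& (j == 2)%N, u == mlcm mu nu & ~~ (mu <= nu)%MM]
            then (mbetti F j u + 1)%N
          else mbetti F j u,
      forall p : nat,
        (gbetti F' j p)%:Z =
          if [&& (j == 1)%N, p == mdeg mu & mdeg nu != p]
            then (gbetti F j p)%:Z + 1
          else if [&& (j == 1)%N, p == mdeg mu & ~~ (mu <= nu)%MM]
            then (gbetti F j p)%:Z + 1
          else if [&& (j == 1)%N, p == mdeg nu & (mu <= nu)%MM]
            then (gbetti F j p)%:Z - 1
          else if [&& (j == 2)%N, p == mdeg (mlcm mu nu) & ~~ (mu <= nu)%MM]
            then (gbetti F j p)%:Z + 1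
          else (gbetti F j p)%:Z
    & betti F' j =
        if ((j == 1)%N || (j == 2)%N) && ~~ (mu <= nu)%MM
          then (betti F j + 1)%N
        else betti F j].
Proof.
have nI1 : ~ I 1.
  rewrite -mpolyX0 => /(gcd_lem hg)/mnm_lepP g0; apply: hg1.
  by apply/mnmP => i; apply/eqP; move: (g0 i); rewrite mnm0E leqn0.
(* At the index [k] the exponent of [mu] is below that of both [g] and [nu]; hence x^mu is not in
   [I] and x^nu does not divide it. *)
have [mu0 _ [k [nukE muk]]] := hmu.
have nImu : ~ I 'X_[mu].
  by move/(gcd_lem hg)/mnm_lepP/(_ k); rewrite -nukE leqNgt muk.
have nnumu : ~~ (nu <= mu)%MM.
  by apply/negP => /mnm_lepP/(_ k); rewrite leqNgt muk.
have munu_neq : mu != nu by apply: contraNneq nnumu => ->; exact: lepm_refl.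
have colon f := @Cset_colon K n I g nu mu f hI hg hmu.
have [a0 sa0] := MinGens_shift hI nI1 hF hnu.
(* With [Fnu], this turns a gain at [mu] and a loss at [nu] into the literal values 1 and 0. *)
have Fmu : mbetti F 1 mu = 0%N.
  apply/eqP; rewrite cards_eq0; apply/eqP/setP => a; rewrite !inE.
  by apply/eqP => sa; apply: nImu; rewrite -sa; exact: (shift1_ideal a hI nI1 hF).
have Fnu : mbetti F 1 nu = 1%N.
  have [i0 [_ [_ _ si0 i0E]]] := resolves_aug hI nI1 hF.
  rewrite /mbetti (_ : [set _ | _] = [set a0]) ?cards1 //.
  apply/setP => a; rewrite !inE -sa0.
  exact: (inj_eq (shift1_inj hF si0 i0E)).
have hJ := monomial_ideal_add mu hI.
have bettiE G i :
    betti G i = #|[set a : 'I_(rk G i) | predT (@shift K n G i a)]|.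
  by rewrite /betti -[LHS]card_ord -cardsT; apply: eq_card => a; rewrite !inE.
have [munu|nmunu] := boolP (mu <= nu)%MM.
  have [d0 [D hR]] :=
    rescale_minimal_free_resolution hI nI1 hF sa0 mu0 munu colon.
  have cnt P := card_shift_rescale a0 mu d0 D j P.
  have {}cnt P : (#|[set i : 'I_(rk F' j) | P (shift i)]| + (j == 1) * P nu =
     #|[set i : 'I_(rk F j) | P (shift i)]| + (j == 1) * P mu)%N.
    by rewrite (card_shift_unique j P hJ hF' hR) -sa0 cnt.
  rewrite !bettiE; split=> [u _ _|p|]; last first.
  - by move: (cnt predT) => /eqP; rewrite eqn_add2r => /eqP->; rewrite andbF.
  - have := cnt (fun v => mdeg v == p); rewrite -/(gbetti F' j p) -/(gbetti F j p).
    (* The degrees of [mu] and [nu] differ, so the gain and the loss occur at different [p]. *)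
    have := mdeg_lt munu munu_neq.
    rewrite !andbF !andbT !(eq_sym p).
    case: (eqVneq j 1%N) => [->|_] /=; last by rewrite !mul0n !addn0 => _ ->.
    have [<-|_] := eqVneq (mdeg mu) p.
      by move=> /gtn_eqF-> /=; rewrite mul1n addn0 => ->; rewrite PoszD.
    rewrite /= !mul1n addn0; case: eqP => [_|_] _ /=; last by rewrite addn0 => ->.
    by move=> <-; rewrite PoszD addrK.
  - have := cnt (pred1 u); rewrite -/(mbetti F' j u) -/(mbetti F j u) /=.
    rewrite !andbF !andbT !(eq_sym u).
    case: (eqVneq j 1%N) => [->|_] /=; last by rewrite !mul0n !addn0.
    rewrite !mul1n; have [<-|_] := eqVneq mu u.
      by rewrite eq_sym (negbTE munu_neq) Fmu addn0.
    have [<-|_] := eqVneq nu u; last by rewrite !addn0.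
    by rewrite Fnu addn0 addn1 => -[].
have [d0 [d1 [x hR]]] :=
  cone_minimal_free_resolution hI nI1 hF sa0 mu0 nmunu nnumu colon.
have cnt P : (#|[set i : 'I_(rk F' j) | P (shift i)]| =
   #|[set i : 'I_(rk F j) | P (shift i)]| + (j == 1) * P mu
     + (j == 2) * P (mlcm mu nu))%N.
  by rewrite (card_shift_unique j P hJ hF' hR) card_shift_cone.
rewrite !bettiE !andbT; split=> [u _ _|p|]; last first.
- rewrite cnt; case: (eqVneq j 1%N) => [->|_]; first by rewrite muln1 addn0.
  by case: eqP => _; rewrite /= ?addn0.
- rewrite /gbetti (cnt (fun v => mdeg v == p)) !andbF !andbT !(eq_sym p).
  case: (eqVneq j 1%N) => [->|_].
    case: eqP => _ /=; last by rewrite !addn0.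
    by rewrite mul0n addn0 if_same PoszD.
  rewrite mul0n addn0 /=; case: (eqVneq j 2%N) => [->|_] /=.
    by case: eqP => _ /=; rewrite ?addn0 // PoszD.
  by rewrite mul0n addn0.
- rewrite /mbetti (cnt (fun v => v == u)) !andbF !andbT !(eq_sym u).
  case: (eqVneq j 1%N) => [->|_].
    case: eqP => [<-|_]; last by rewrite !addn0.
    by move: Fmu; rewrite /mbetti => ->.
  rewrite mul0n addn0 /=; case: (eqVneq j 2%N) => [->|_] /=.
    by case: eqP => _ /=; rewrite ?addn0.
  by rewrite mul0n addn0.
Qed.
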